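(* If $G$ and $H$ are finitely generated abelian groups, then there is a natural equivalence $$\mathbb{E}(G,H)\;\cong\;\operatorname{Hom}_{\mathsf{Ab}}(G\otimes\mathbb{R},\,H\otimes\mathbb{R}).$$ In particular (confirming a conjecture of Shipman), $\mathbb{E}(\mathbb{Z}^n,\mathbb{Z}^n)$ is isomorphic to the group of $n\times n$ matrices over $\mathbb{R}$ under addition.
   Context: For abelian groups $G$ and $H$, the set of all functions $G\to H$ is an abelian group under pointwise addition. $B(G,H)$ is the subgroup of functions with finite range, and $S(G,H)$ is the subgroup of almost homomorphisms, i.e. functions $f:G\to H$ for which $d_f(x,y)=f(x+y)-f(x)-f(y)$ defines a function $G\times G\to H$ with finite range; $B(G,H)$ is a subgroup of $S(G,H)$. $\mathbb{E}(G,H)$ denotes the quotient group $S(G,H)/B(G,H)$. $\mathsf{Ab}$ denotes the category of abelian groups, and $\operatorname{Hom}_{\mathsf{Ab}}(A,B)$ the abelian group of morphisms $A\to B$ in $\mathsf{Ab}$; $\otimes$ is the tensor product of abelian groups, with $\mathbb{R}$ the additive group of real numbers. $\mathbb{E}(\_,\_)$ is a bifunctor $\mathsf{Ab}\times\mathsf{Ab}\to\mathsf{Ab}$, contravariant in its first argument and covariant in its second, with homomorphisms acting by composition.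
   Formalization: Hom_Ab(G⊗ℝ, H⊗ℝ) is taken to be the group of ℝ-linear maps, not all group homomorphisms: with all homomorphisms the claim fails for G = H = ℤ, where 𝔼(ℤ,ℤ) has the cardinality of ℝ but Hom_Ab(ℝ,ℝ) is strictly larger. *)

(* Defs.v *)
From HB Require Import structures.
From mathcomp Require Import all_boot all_order all_algebra.
From mathcomp Require Import boolp classical_sets functions cardinality.
From mathcomp Require Import reals.
From mathcomp Require Import freeg.

Set Implicit Arguments.
Unset Strict Implicit.
Unset Printing Implicit Defensive.

Import GRing.Theory.
Local Open Scope ring_scope.
Local Open Scope quotient_scope.

(* Abelian groups are zmodTypes and their homomorphisms are {additive G -> H};
   the group of all functions G -> H under pointwise addition is the library's
   zmodType structure on G -> H. *)

Definition finitely_generated (G : zmodType) : Prop :=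
  exists (n : nat) (g : 'I_n -> G),
    forall x : G, exists c : 'I_n -> int, x = \sum_(i < n) g i *~ c i.

Record fgAb := FgAb {
  fgAb_sort :> zmodType;
  fgAb_axiom : finitely_generated fgAb_sort }.

Section AlmostHomomorphisms.
Variables G H : zmodType.
Implicit Types f g : G -> H.

Definition finite_range (T : Type) (f : T -> H) : Prop := finite_set (range f).

Definition defect f (xy : G * G) : H := f (xy.1 + xy.2) - f xy.1 - f xy.2.

Definition bounded : {pred G -> H} := fun f => `[< finite_range f >].

Definition almost_additive : {pred G -> H} :=
  fun f => `[< finite_range (defect f) >].

Lemma finite_rangeB (T : Type) (f g : T -> H) :
  finite_range f -> finite_range g -> finite_range (fun x => f x - g x).
Proof.
move=> ff fg; apply: sub_finite_set
  (finite_image2 (fun a b => a - b) ff fg).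
by move=> _ [x _ <-]; exists (f x) => //; exists (g x).
Qed.

Lemma finite_range0 (T : Type) : finite_range (fun _ : T => 0 : H).
Proof.
by apply: sub_finite_set (finite_set1 (0 : H)) => _ [x _ <-].
Qed.

Lemma bounded_zmod_closed : zmod_closed bounded.
Proof.
split; first exact/asboolP/finite_range0.
by move=> f g /asboolP ff /asboolP fg; apply/asboolP/finite_rangeB.
Qed.

HB.instance Definition _ :=
  GRing.isZmodClosed.Build (G -> H) bounded bounded_zmod_closed.

Lemma defectB f g : defect (f - g) = (fun xy => defect f xy - defect g xy).
Proof.
apply/funext => -[x y] /=; rewrite /defect /= !fctE.
by rewrite !opprD !opprK (addrACA (f (x + y))) (addrACA (f (x + y) - f x)).
Qed.

Lemma almost_additive_zmod_closed : zmod_closed almost_additive.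
Proof.
split.
  apply/asboolP; have -> : defect (0 : G -> H) = fun=> 0; last exact: finite_range0.
  apply/funext => xy; transitivity (0 - 0 - 0 : H); first by [].
  by rewrite !subr0.
move=> f g /asboolP ff /asboolP fg; apply/asboolP.
by rewrite defectB; exact: finite_rangeB.
Qed.

HB.instance Definition _ :=
  GRing.isZmodClosed.Build (G -> H) almost_additive almost_additive_zmod_closed.

Lemma bounded_almost_additive f : f \in bounded -> f \in almost_additive.
Proof.
move=> /asboolP ff; apply/asboolP; apply: finite_rangeB.
  apply: finite_rangeB.
  - by apply: sub_finite_set ff => _ [xy _ <-]; exists (xy.1 + xy.2).
  - by apply: sub_finite_set ff => _ [xy _ <-]; exists xy.1.
by apply: sub_finite_set ff => _ [xy _ <-]; exists xy.2.
Qed.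

(* S(G, H) *)
Record almost_hom := AlmostHom {
  almost_hom_val :> G -> H;
  almost_hom_valP : almost_hom_val \in almost_additive }.

HB.instance Definition _ := [isSub for almost_hom_val].
HB.instance Definition _ := [Choice of almost_hom by <:].
HB.instance Definition _ := [SubChoice_isSubZmodule of almost_hom by <:].

(* B(G, H), as a subgroup of S(G, H) *)
Definition bounded_almost_hom : {pred almost_hom} :=
  fun x => (x : G -> H) \in bounded.

Lemma bounded_almost_hom_zmod_closed : zmod_closed bounded_almost_hom.
Proof.
split; first exact: (rpred0 bounded).
by move=> x y Bx By; exact: (rpredB Bx By).
Qed.

HB.instance Definition _ := GRing.isZmodClosed.Build almost_hom
  bounded_almost_hom bounded_almost_hom_zmod_closed.

Definition E := Quotient.quot bounded_almost_hom.

HB.instance Definition _ := GRing.Zmodule.on E.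

Definition E_class (f : almost_hom) : E := \pi_(Quotient.quot bounded_almost_hom) f.

Lemma E_classB : {morph E_class : x y / x - y}.
Proof. by move=> x y; rewrite /E_class raddfB. Qed.

Lemma E_class_eq (f g : almost_hom) :
  E_class f = E_class g <-> (f - g : almost_hom) \in bounded_almost_hom.
Proof. by rewrite Quotient.idealrBE; split=> [/eqP|/eqP]. Qed.

End AlmostHomomorphisms.


Arguments E_class {G H} f.

Section EFunctor.
Variables (G G' H H' : zmodType).
Variables (u : {additive G' -> G}) (v : {additive H -> H'}).

Lemma almost_hom_comp_subproof (f : almost_hom G H) :
  v \o f \o u \in @almost_additive G' H'.
Proof.
have /asboolP ff := almost_hom_valP f; apply/asboolP.
apply: sub_finite_set (finite_image v ff) => _ [xy _ <-] /=.
exists (defect f (u xy.1, u xy.2)); first by exists (u xy.1, u xy.2).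
by rewrite /defect /= !raddfB raddfD.
Qed.

Definition almost_hom_comp (f : almost_hom G H) : almost_hom G' H' :=
  AlmostHom (almost_hom_comp_subproof f).

Definition E_map (x : E G H) : E G' H' := E_class (almost_hom_comp (repr x)).

Lemma E_map_class (f : almost_hom G H) :
  E_map (E_class f) = E_class (almost_hom_comp f).
Proof.
apply/E_class_eq.
have /asboolP Bf : repr (E_class f) - f \in @bounded_almost_hom G H.
  by apply/E_class_eq; rewrite /E_class reprK.
apply/asboolP; apply: sub_finite_set (finite_image v Bf) => _ [x _ <-] /=.
by exists ((repr (E_class f) - f : almost_hom G H) (u x)); [exists (u x) | rewrite raddfB].
Qed.

Lemma E_map_is_zmod_morphism : zmod_morphism E_map.
Proof.
move=> x y; rewrite -[x]reprK -[y]reprK -!/(E_class _) -E_classB.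
rewrite !E_map_class -E_classB; congr E_class; apply: val_inj.
by apply/funext => z; exact: (raddfB v).
Qed.

HB.instance Definition _ :=
  GRing.isZmodMorphism.Build (E G H) (E G' H') E_map E_map_is_zmod_morphism.

End EFunctor.

Section TensorProduct.
Variables A B : zmodType.

(* The relators of the presentation of the tensor product of A and B by the
   generators (a, b) in A * B. *)
Inductive tensor_relator : {freeg (A * B) / int} -> Prop :=
| TensorRelatorl a a' b :
    tensor_relator (<< (a + a', b) >> - << (a, b) >> - << (a', b) >>)
| TensorRelatorr a b b' :
    tensor_relator (<< (a, b + b') >> - << (a, b) >> - << (a, b') >>).

(* The subgroup generated by the relators. *)
Definition tensor_relations : {pred {freeg (A * B) / int}} := fun x =>
  `[< forall P : {freeg (A * B) / int} -> Prop,
        P 0 -> (forall y z, P y -> P z -> P (y - z)) ->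
        (forall r, tensor_relator r -> P r) -> P x >].

Lemma tensor_relations_zmod_closed : zmod_closed tensor_relations.
Proof.
split; first by apply/asboolP => P P0 PB Pr; exact: P0.
move=> x y /asboolP Px /asboolP Py; apply/asboolP => P P0 PB Pr.
by apply: (PB); [exact: Px | exact: Py].
Qed.

HB.instance Definition _ := GRing.isZmodClosed.Build {freeg (A * B) / int}
  tensor_relations tensor_relations_zmod_closed.

Definition tensor := Quotient.quot tensor_relations.

HB.instance Definition _ := GRing.Zmodule.on tensor.

Definition tens (a : A) (b : B) : tensor :=
  \pi_(Quotient.quot tensor_relations) << (a, b) >>.

Lemma tens_relator r : tensor_relator r ->
  \pi_(Quotient.quot tensor_relations) r = 0.
Proof.
move=> rr; rewrite -(raddf0 (\pi_(Quotient.quot tensor_relations))).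
by apply/eqP; rewrite -Quotient.idealrBE subr0; apply/asboolP => P _ _; exact.
Qed.

Lemma tensDl a a' b : tens (a + a') b = tens a b + tens a' b.
Proof.
apply/subr0_eq; rewrite opprD addrA.
by rewrite -(tens_relator (TensorRelatorl a a' b)) !raddfB.
Qed.

Lemma tensDr a b b' : tens a (b + b') = tens a b + tens a b'.
Proof.
apply/subr0_eq; rewrite opprD addrA.
by rewrite -(tens_relator (TensorRelatorr a b b')) !raddfB.
Qed.

Lemma tensor_ind (P : tensor -> Prop) :
  P 0 -> (forall s t, P s -> P t -> P (s - t)) ->
  (forall a b, P (tens a b)) -> forall t, P t.
Proof.
move=> P0 PB Ptens t.
have PN s : P s -> P (- s) by move=> Ps; rewrite -sub0r; exact: PB.
have PD s s' : P s -> P s' -> P (s + s').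
  by move=> Ps Ps'; rewrite -[s']opprK; apply/PB/PN.
rewrite -[t]reprK -[repr t]freeg_sumE raddf_sum.
elim/big_ind: _ => // -[a b] _.
rewrite -[coeff _ _]intz -freegU_mulz raddfMz.
suff PM n : P (tens a b *+ n) by case: (coeff _ _) => n; [|apply: PN]; exact: PM.
by elim: n => [|n IHn]; rewrite ?mulr0n // mulrS; exact: PD.
Qed.

Section Lift.
Variables (C : zmodType) (f : A -> B -> C).

Definition tensor_lift (t : tensor) : C :=
  @fglift int (zmodule C) (A * B)%type (fun ab => f ab.1 ab.2) (repr t).

Hypothesis fDl : forall a a' b, f (a + a') b = f a b + f a' b.
Hypothesis fDr : forall a b b', f a (b + b') = f a b + f a b'.

Let lift : {freeg (A * B) / int} -> C :=
  @fglift int (zmodule C) (A * B)%type (fun ab => f ab.1 ab.2).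

Let liftB : {morph lift : x y / x - y}.
Proof. exact: (@lift_is_additive int _ (zmodule C)). Qed.

Let liftU a b : lift << (a, b) >> = f a b.
Proof. by rewrite /lift liftU scale1r. Qed.

Let tensor_lift_pi x :
  tensor_lift (\pi_(Quotient.quot tensor_relations) x) = lift x.
Proof.
apply/subr0_eq; rewrite -liftB.
have : repr (\pi_(Quotient.quot tensor_relations) x) - x \in tensor_relations.
  by rewrite Quotient.idealrBE reprK.
move=> /asboolP /(_ (fun y => lift y = 0)); apply.
- by have := liftB 0 0; rewrite !subrr.
- by move=> y z y0 z0; rewrite liftB y0 z0 subr0.
- by move=> _ [a a' b|a b b']; rewrite !liftB !liftU ?fDl ?fDr -addrA -opprD subrr.
Qed.

Lemma tensor_lift_tens a b : tensor_lift (tens a b) = f a b.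
Proof. by rewrite tensor_lift_pi liftU. Qed.

Lemma tensor_lift_is_zmod_morphism : zmod_morphism tensor_lift.
Proof.
move=> s t; rewrite -[s]reprK -[t]reprK -raddfB.
by rewrite !tensor_lift_pi liftB.
Qed.

End Lift.
End TensorProduct.

Section TensorMap.
Variables (A A' B B' : zmodType) (u : {additive A -> A'}) (v : {additive B -> B'}).

Definition tensor_map : tensor A B -> tensor A' B' :=
  tensor_lift (fun a b => tens (u a) (v b)).

Let tDl a a' b : tens (u (a + a')) (v b) = tens (u a) (v b) + tens (u a') (v b).
Proof. by rewrite raddfD tensDl. Qed.

Let tDr a b b' : tens (u a) (v (b + b')) = tens (u a) (v b) + tens (u a) (v b').
Proof. by rewrite raddfD tensDr. Qed.

Lemma tensor_map_tens a b : tensor_map (tens a b) = tens (u a) (v b).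
Proof. exact: tensor_lift_tens. Qed.

Lemma tensor_map_is_zmod_morphism : zmod_morphism tensor_map.
Proof. exact: tensor_lift_is_zmod_morphism. Qed.

HB.instance Definition _ := GRing.isZmodMorphism.Build (tensor A B)
  (tensor A' B') tensor_map tensor_map_is_zmod_morphism.

End TensorMap.

(* The tensor product of A with the additive group of R; R acts on the second
   factor by multiplication. *)
Section ScalarExtension.
Variables (R : comNzRingType) (A : zmodType).

Definition tensR : Type := tensor A R.

HB.instance Definition _ := GRing.Zmodule.on tensR.

Definition tensR_scale (r : R) (t : tensR) : tensR :=
  tensor_map (idfun : {additive A -> A}) (r \*o idfun : {additive R -> R}) t.

Let scaleE r a x : tensR_scale r (tens a x) = tens a (r * x).
Proof. exact: tensor_map_tens. Qed.

Let scaleB r : {morph tensR_scale r : s t / s - t}.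
Proof. by move=> s t; rewrite /tensR_scale raddfB. Qed.

Let scale0 r : tensR_scale r 0 = 0.
Proof. by have := scaleB r 0 0; rewrite !subrr. Qed.

Lemma tensR_scaleA r s t :
  tensR_scale r (tensR_scale s t) = tensR_scale (r * s) t.
Proof.
elim/tensor_ind: t => [|t t' IH IH'|a x]; first by rewrite !scale0.
  by rewrite !scaleB IH IH'.
by rewrite !scaleE mulrA.
Qed.

Lemma tensR_scale1 : left_id 1 tensR_scale.
Proof.
elim/tensor_ind => [|t t' IH IH'|a x]; first by rewrite scale0.
  by rewrite scaleB IH IH'.
by rewrite scaleE mul1r.
Qed.

Lemma tensR_scaleDr : right_distributive tensR_scale +%R.
Proof. by move=> r s t; rewrite /tensR_scale raddfD. Qed.

Lemma tensR_scaleDl t : {morph tensR_scale^~ t : r s / r + s}.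
Proof.
move=> r s; elim/tensor_ind: t => [|t t' IH IH'|a x].
- by rewrite !scale0 addr0.
- by rewrite !scaleB IH IH' opprD addrACA.
- by rewrite !scaleE mulrDl tensDr.
Qed.

HB.instance Definition _ := GRing.Zmodule_isLmodule.Build R tensR
  tensR_scaleA tensR_scale1 tensR_scaleDr tensR_scaleDl.

Lemma tensR_scale_tens (r : R) (a : A) (x : R) :
  r *: (tens a x : tensR) = tens a (r * x).
Proof. exact: scaleE. Qed.

End ScalarExtension.

Section ScalarExtensionMap.
Variables (R : comNzRingType) (A A' : zmodType) (u : {additive A -> A'}).

Definition tensR_map : tensR R A -> tensR R A' :=
  tensor_map u (idfun : {additive R -> R}).

Lemma tensR_map_tens a x : tensR_map (tens a x) = tens (u a) x.
Proof. exact: tensor_map_tens. Qed.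

Lemma tensR_map_is_linear : linear tensR_map.
Proof.
have mapB : {morph tensR_map : s t / s - t} by exact: raddfB.
have mapD : {morph tensR_map : s t / s + t} by exact: raddfD.
have map0 : tensR_map 0 = 0 by have := mapB 0 0; rewrite !subrr.
move=> r s t; rewrite mapD; congr (_ + _).
elim/tensor_ind: s => [|s s' IH IH'|a x]; first by rewrite scaler0 map0 scaler0.
  by rewrite scalerBr !mapB IH IH' scalerBr.
by rewrite tensR_scale_tens !tensR_map_tens tensR_scale_tens.
Qed.

HB.instance Definition _ := GRing.isLinear.Build R (tensR R A) (tensR R A')
  *:%R tensR_map tensR_map_is_linear.

End ScalarExtensionMap.

(* The abelian group, under pointwise addition, of R-linear maps U -> V.
   Additive maps would be too many: for U = V = R, R the reals, they include
   all Q-linear endomorphisms of R, whereas E int int has the cardinality of R. *)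
Section LinearHom.
Variables (R : comNzRingType) (U V : lmodType R).

Definition is_linear : {pred U -> V} := fun f => `[< linear f >].

Lemma is_linear_zmod_closed : zmod_closed is_linear.
Proof.
split; first by apply/asboolP => r x y; rewrite /= scaler0 addr0.
move=> f g /asboolP fL /asboolP gL; apply/asboolP => r x y.
rewrite -[LHS]/(f (r *: x + y) - g (r *: x + y)) fL gL.
by rewrite opprD addrACA -scalerBr.
Qed.

HB.instance Definition _ :=
  GRing.isZmodClosed.Build (U -> V) is_linear is_linear_zmod_closed.

Record linear_hom := LinearHom {
  linear_hom_val :> U -> V;
  linear_hom_valP : linear_hom_val \in is_linear }.

HB.instance Definition _ := [isSub for linear_hom_val].
HB.instance Definition _ := [Choice of linear_hom by <:].
HB.instance Definition _ := [SubChoice_isSubZmodule of linear_hom by <:].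

End LinearHom.

Section LinearHomFunctor.
Variables (R : comNzRingType) (U U' V V' : lmodType R).
Variables (u : {linear U' -> U}) (v : {linear V -> V'}).

Lemma linear_hom_map_subproof (f : linear_hom U V) : v \o f \o u \in @is_linear R U' V'.
Proof.
have /asboolP fL := linear_hom_valP f; apply/asboolP => r x y /=.
by rewrite linearP fL linearP.
Qed.

Definition linear_hom_map (f : linear_hom U V) : linear_hom U' V' :=
  LinearHom (linear_hom_map_subproof f).

End LinearHomFunctor.

Arguments tensR_map R {A A'} u _.

(* Main.v *)
Require Import Defs.
From HB Require Import structures.
From mathcomp Require Import all_boot all_order all_algebra.
From mathcomp Require Import boolp classical_sets functions cardinality.
From mathcomp Require Import reals.
From mathcomp Require Import lra.
Import Order.TTheory GRing.Theory Num.Theory.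
Local Open Scope ring_scope.

Set Implicit Arguments.
Unset Strict Implicit.
Unset Printing Implicit Defensive.

(** The R-linear map attached to an almost homomorphism f : G -> H is the only
    R-linear F from G (x) R to H (x) R that stays at bounded distance from f:
    for every linear functional l on H (x) R, the function
    x |-> l (f x (x) 1) - l (F (x (x) 1)) is bounded (approximates).
    This characterization mentions no basis and no limit, so additivity of
    f |-> F and naturality in G and H follow from uniqueness alone: the
    difference, or the composite with homomorphisms, of approximated maps
    approximates the one wanted.

    Coordinates on H enter through finitely_generated_split: there are elements
    h_j of H and homomorphisms chi_j : H -> Z such that
    x - sum_j chi_j(x) h_j takes finitely many values.  These values are
    torsion, so the h_j (x) 1 span H (x) R with coordinates the extensions of
    the chi_j.  Granted this:
    - F exists because each chi_j o f is a real function with bounded defect,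
      hence at bounded distance from a homomorphism phi_j : G -> R
      (quasi_additive_limit, a theorem of Hyers), and
      F (x (x) 1) = sum_j phi_j(x) (h_j (x) 1) works;
    - F is unique because a linear F with bounded values on the multiples of
      x (x) 1 kills x (x) 1;
    - f |-> F has kernel B(G, H): when F = 0 the integers chi_j (f x) are
      bounded, so f has finite range;
    - f |-> F is onto: given F, round down the coordinates of F (x (x) 1).

    For H = Z^n, the linear endomorphisms of Z^n (x) R correspond to their
    matrices in the standard basis (matrix_of_hom_bijective). *)

(** * Functions with finite range *)

Lemma finite_range_comp (T : Type) (H K : zmodType) (v : H -> K) (f : T -> H) :
  finite_range f -> finite_range (v \o f).
Proof.
by move=> ff; apply: sub_finite_set (finite_image v ff) => _ [x _ <-];
  exists (f x); first exists x.
Qed.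

Lemma finite_rangeD (T : Type) (H : zmodType) (f g : T -> H) :
  finite_range f -> finite_range g -> finite_range (fun x => f x + g x).
Proof.
move=> ff fg; apply: sub_finite_set
  (finite_image2 (fun a b => a + b) ff fg).
by move=> _ [x _ <-]; exists (f x) => //; exists (g x).
Qed.

Lemma finite_range_sum (T I : Type) (H : zmodType) (r : seq I) (P : pred I)
    (f : I -> T -> H) :
  (forall i, P i -> finite_range (f i)) ->
  finite_range (fun x => \sum_(i <- r | P i) f i x).
Proof.
move=> ff; elim: r => [|i r IHr].
  by under eq_fun do rewrite big_nil; exact: finite_range0.
under eq_fun do rewrite big_cons.
by case Pi: (P i) => //; apply: finite_rangeD => //; exact: ff.
Qed.

Lemma finite_range_bounded (R : realType) (T : Type) (H : zmodType)
    (f : T -> H) (w : H -> R) :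
  finite_range f -> exists C, forall x, `|w (f x)| <= C.
Proof.
move=> /finite_seqP [s fs]; exists (\sum_(y <- s) `|w y|) => x.
have : f x \in s by have : [set` s]%classic (f x) by rewrite -fs; exists x.
move=> xs; rewrite (big_rem (f x)) //= lerDl.
by apply: sumr_ge0 => *; exact: normr_ge0.
Qed.

Lemma bounded_int_finite_range (R : realType) (T : Type) (f : T -> int)
    (C : R) :
  (forall x, `|(f x)%:~R| <= C) -> finite_range f.
Proof.
move=> fC; pose N := Num.bound C.
apply: sub_finite_set
  (finite_image (fun k : nat => k%:Z - N%:Z) (finite_II (N + N).+1)).
move=> _ [x _ <-].
have [k kE kN] : exists2 k : nat, f x = k%:Z - N%:Z & (k < (N + N).+1)%N.
  have /ltW : `|(f x)%:~R : R| < N%:R.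
    apply: le_lt_trans (fC x) (archi_boundP _).
    exact: le_trans (normr_ge0 _) (fC x).
  rewrite -intr_norm -[N%:R]/((N%:Z)%:~R) ler_int ler_norml => /andP[lo hi].
  exists `|(f x + N%:Z)%R|%N.
    by rewrite gez0_abs ?addrK // -lerBlDr sub0r.
  rewrite ltnS -lez_nat gez0_abs; first by rewrite PoszD lerD2r.
  by rewrite -lerBlDr sub0r.
by exists k.
Qed.

(** * Homomorphisms near real functions with bounded defect *)

Lemma mulrn_bounded_eq0 (R : realType) (t D : R) :
  (forall n, `|t *+ n| <= D) -> t = 0.
Proof.
move=> tD; apply/eqP; rewrite -normr_eq0 eq_le normr_ge0 andbT leNgt.
apply/negP => t0.
have D0 : 0 <= D / `|t| by rewrite divr_ge0 ?(ltW t0) // (le_trans _ (tD 0%N)).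
have := archi_boundP D0; rewrite ltr_pdivrMr //.
move=> /(le_lt_trans (tD (Num.bound (D / `|t|)))).
by rewrite -[t *+ _]mulr_natl normrM normr_nat ltxx.
Qed.

Section Hyers.
Variables (R : realType) (G : zmodType) (q : G -> R) (C : R).
Hypothesis qC : forall x y, `|q (x + y) - q x - q y| <= C.

Let C_ge0 : 0 <= C. Proof. exact: le_trans (qC 0 0). Qed.

Local Lemma quasi_mulrn x n : `|q (x *+ n.+1) - q x * n.+1%:R| <= C * n%:R.
Proof.
elim: n => [|n]; first by rewrite mulr1n mulr1 subrr normr0 mulr0.
have := qC x (x *+ n.+1); rewrite -mulrS -!(natr1 n.+1) -(natr1 n) !ler_norml.
set a := q (x *+ n.+2); set b := q (x *+ n.+1).
by move=> /andP[? ?] /andP[? ?]; apply/andP; split; nra.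
Qed.

(** The number t is the limit of q (n x) / n, obtained as the supremum of the
    lower bounds (q (n x) - C) / n: comparing q (m n x) with m q (n x) and with
    n q (m x) shows that each of them lies below each (q (m x) + C) / m. *)
Lemma quasi_limit_exists x : exists t, forall n, `|q (x *+ n) - t *+ n| <= C.
Proof.
pose a n := q (x *+ n.+1).
pose A := [set r | exists n, r = (a n - C) / n.+1%:R]%classic.
have A0 : (A !=set0)%classic by exists ((a 0%N - C) / 1), 0%N.
have a_le n m : (a n - C) / n.+1%:R <= (a m + C) / m.+1%:R.
  rewrite ler_pdivrMr ?ltr0n // mulrAC ler_pdivlMr ?ltr0n //.
  have := quasi_mulrn (x *+ n.+1) m; have := quasi_mulrn (x *+ m.+1) n.
  rewrite -!mulrnA (mulnC m.+1) -/(a m) -/(a n) !ler_norml -!natr1.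
  have C0 := C_ge0; set b := q _; move=> /andP[? ?] /andP[? ?]; lra.
have Aub m : ubound A ((a m + C) / m.+1%:R) by move=> _ [n ->].
exists (sup A) => -[|n].
  rewrite !mulr0n subr0; have := qC 0 0.
  by rewrite addr0 subrr sub0r normrN.
have lo : (a n - C) / n.+1%:R <= sup A.
  by apply: ub_le_sup; [exists ((a n + C) / n.+1%:R) | exists n].
have hi : sup A <= (a n + C) / n.+1%:R by exact: ge_sup.
rewrite -/(a n) -mulr_natr ler_norml.
rewrite ler_pdivrMr ?ltr0n // in lo; rewrite ler_pdivlMr ?ltr0n // in hi.
by apply/andP; split; lra.
Qed.

(** A real t with q (n x) - n t bounded in n is unique, which forces the limit
    at x - y to be the difference of the limits at x and y. *)
Lemma quasi_additive_limit :
  exists phi : {additive G -> R}, forall x, `|q x - phi x| <= C.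
Proof.
have /choice[phi phiC] := quasi_limit_exists.
have phiB : zmod_morphism phi.
  move=> x y; apply/subr0_eq; apply: (@mulrn_bounded_eq0 _ _ (4 * C)) => n.
  have := phiC (x - y) n; have := phiC x n; have := phiC y n.
  have := qC (x *+ n - y *+ n) (y *+ n); rewrite subrK -mulrnBl.
  rewrite !mulrnBl !ler_norml.
  move=> /andP[? ?] /andP[? ?] /andP[? ?] /andP[? ?].
  by apply/andP; split; lra.
pose phi_add := GRing.isZmodMorphism.Build G R phi phiB.
pose phiA : {additive G -> R} := HB.pack phi phi_add.
by exists phiA => x; exact: (phiC x 1%N).
Qed.

End Hyers.

(** * Splitting off the torsion of a finitely generated group *)

Section Splitting.
Variables (H : zmodType) (n : nat).

Definition int_comb (g : 'I_n -> H) (c : 'rV[int]_n) : H := \sum_i g i *~ c 0 i.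

Lemma int_combB g : zmod_morphism (int_comb g).
Proof.
move=> c d; rewrite -sumrB; apply: eq_bigr => i _.
by rewrite !mxE mulrzBr.
Qed.

HB.instance Definition _ g :=
  GRing.isZmodMorphism.Build _ _ (int_comb g) (int_combB g).

Lemma int_comb_mul g m (a : 'rV[int]_m) (M : 'M[int]_(m, n)) :
  int_comb g (a *m M) = \sum_k int_comb g (row k M) *~ a 0 k.
Proof.
rewrite mulmx_sum_row raddf_sum; apply: eq_bigr => k _ /=.
rewrite /int_comb mulrz_suml; apply: eq_bigr => i _.
by rewrite !mxE mulrC mulrzA.
Qed.

Lemma torsion_multiples_finite_range (T : Type) (h : H) (d : int)
    (c : T -> int) :
  d != 0 -> h *~ d = 0 -> finite_range (fun x => h *~ c x).
Proof.
move=> d0 hd.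
have -> : (fun x => h *~ c x) =
    (fun k : int => h *~ k) \o (fun x => (c x %% d)%Z).
  apply/funext => x /=; rewrite [in LHS](divz_eq (c x) d) mulrzDr mulrC.
  by rewrite mulrzA hd mul0rz add0r.
apply: finite_range_comp.
apply: sub_finite_set (finite_image Posz (finite_II `|d|%N)) => _ [x _ <-].
exists `|(c x %% d)%Z|%N; last by rewrite gez0_abs // modz_ge0.
by rewrite /= -ltz_nat gez0_abs ?modz_ge0 // abszE ltz_mod.
Qed.

(** After the change of generators h = U g, every relation has coefficient 0 on
    the generators with d j = 0, and the other generators are torsion.  It
    suffices to diagonalize, by the Smith normal form, a matrix M of relations
    of maximal rank: by maximality every relation is a rational combination of
    the rows of M. *)
Lemma diagonal_relations (g : 'I_n -> H) :
  exists (U : 'M[int]_n) (d : 'I_n -> int),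
    [/\ U \in unitmx,
        forall j, d j != 0 -> int_comb g (row j U) *~ d j = 0 &
        forall c, int_comb g c = 0 ->
          forall j, d j = 0 -> (c *m invmx U) 0 j = 0].
Proof.
pose P k := `[< exists r (M : 'M[int]_(r, n)),
  (forall i, int_comb g (row i M) = 0) /\
  \rank (map_mx (intr : int -> rat) M) = k >].
have P0 : exists k, P k.
  exists 0%N; apply/asboolP; exists 0%N, 0; split; first by case.
  by rewrite map_mx0 mxrank0.
have Pn k : P k -> (k <= n)%N.
  by move=> /asboolP [r [M [_ <-]]]; exact: rank_leq_col.
case: (ex_maxnP P0 Pn) => k /asboolP[r [M [gM rM]]] maxk.
have [L Lu [U Uu [d _ MLDU]]] := int_Smith_normal_form M.
set D := (\matrix_(_, _) _) in MLDU.
(* M has only r rows, so no multiple of a generator of index j >= r is known to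
   vanish, whatever the list d contains there. *)
pose d' (j : 'I_n) : int := if (j < r)%N then d`_j else 0.
exists U, d'; split=> //.
- move=> j; rewrite /d'; case: ltnP => [jr dj|]; last by rewrite eqxx.
  have <- : int_comb g (row (Ordinal jr) (invmx L *m M)) =
      int_comb g (row j U) *~ d`_j.
    rewrite MLDU !mulmxA mulVmx // mul1mx row_mul int_comb_mul (bigD1 j) //=.
    rewrite !mxE /= eqxx mulr1n big1 ?addr0 // => i ij.
    by rewrite !mxE /= eq_sym (negbTE (_ : i != j :> nat)) // mulr0n mulr0z.
  by rewrite row_mul int_comb_mul big1 // => i _; rewrite gM mul0rz.
move=> c gc j d'j.
pose Q := map_mx (intr : int -> rat).
have /submxP[a aE] : (Q _ _ c <= Q _ _ M)%MS.
  have sM : (Q _ _ M <= Q _ _ (col_mx M c))%MS.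
    by rewrite /Q map_col_mx -addsmxE addsmxSl.
  have [rle req] := mxrank_leqif_sup sM.
  apply: submx_trans (_ : (Q _ _ (col_mx M c) <= _)%MS).
    by rewrite /Q map_col_mx -addsmxE addsmxSr.
  rewrite -req eqn_leq rle /= [X in (_ <= X)%N]rM; apply: maxk; apply/asboolP.
  exists (r + 1)%N, (col_mx M c); split => // i.
  case: (split_ordP i) => i' ->; first by rewrite rowKu gM.
  by rewrite rowKd row_id.
have QD : Q _ _ (c *m invmx U) = a *m Q _ _ L *m Q _ _ D.
  rewrite /Q map_mxM -/(Q _ _ c) aE MLDU /Q !map_mxM -!mulmxA -map_mxM.
  by rewrite mulmxV // map_mx1 mulmx1.
apply/eqP; rewrite -(intr_eq0 rat); apply/eqP.
have -> : ((c *m invmx U) 0 j)%:~R = Q _ _ (c *m invmx U) 0 j :> rat.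
  by rewrite /Q [RHS]mxE.
rewrite QD mxE big1 // => i _; rewrite /Q !mxE.
case: eqP => [ij|]; last by rewrite mulr0n mulr0.
by move: d'j; rewrite /d' -ij ltn_ord => ->; rewrite mul0rn mulr0.
Qed.

End Splitting.

(** The coordinates of x along the generators h_j with d j = 0 do not depend on
    the chosen expression of x, by the previous lemma; what remains of x is a
    sum of multiples of torsion elements. *)
Lemma finitely_generated_split (H : zmodType) : finitely_generated H ->
  exists (m : nat) (h : 'I_m -> H) (chi : 'I_m -> {additive H -> int}),
    finite_range (fun x => x - \sum_j h j *~ chi j x).
Proof.
move=> [n [g gen]].
have [U [d [Uu dU coordU]]] := diagonal_relations g.
have /choice[c cE] : forall x, exists c : 'rV[int]_n, x = int_comb g c.
  move=> x; have [c cE] := gen x; exists (\row_i c i).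
  by rewrite [LHS]cE; apply: eq_bigr => i _; rewrite mxE.
pose chi j x : int := if d j == 0 then (c x *m invmx U) 0 j else 0.
have chiB j : zmod_morphism (chi j).
  move=> x y; rewrite /chi; case: eqP => dj; last by rewrite subr0.
  apply/subr0_eq.
  have := coordU (c (x - y) - (c x - c y)) _ j dj.
  rewrite !mulmxBl !mxE; apply.
  by rewrite !(raddfB (int_comb g)) /= -!cE subrr.
pose chiA j : {additive H -> int} :=
  HB.pack (chi j) (GRing.isZmodMorphism.Build H int (chi j) (chiB j)).
exists n, (fun j => int_comb g (row j U)), chiA.
have -> : (fun x => x - \sum_j int_comb g (row j U) *~ chiA j x) =
    (fun x => \sum_(j | d j != 0) int_comb g (row j U) *~ (c x *m invmx U) 0 j).
  apply/funext => x; rewrite {1}(cE x) -{1}[c x](mulmxKV Uu) int_comb_mul.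
  rewrite (bigID (fun j => d j == 0)) /=.
  rewrite [X in _ - X](bigID (fun j => d j == 0)) /=.
  rewrite [X in _ - (_ + X)]big1 ?addr0; last first.
    by move=> j dj; rewrite /chi (negbTE dj) mulr0z.
  rewrite addrC; apply/eqP; rewrite subr_eq; apply/eqP; congr (_ + _).
  by apply: eq_bigr => j dj; rewrite /chi dj.
apply: finite_range_sum => j dj.
exact: torsion_multiples_finite_range dj (dU j dj).
Qed.

(** * Coordinates on the scalar extension *)

Section ScalarExtensionOfFunctions.
Variables (R : comNzRingType) (A : zmodType).

Definition tens1 (a : A) : tensR R A := tens a 1.

Lemma tens1_is_zmod_morphism : zmod_morphism tens1.
Proof. move=> a b; apply/esym/subr0_eq/eqP.
by rewrite subr_eq0 subr_eq -tensDl subrK. Qed.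

HB.instance Definition _ :=
  GRing.isZmodMorphism.Build A (tensR R A) tens1 tens1_is_zmod_morphism.

Lemma tensE a (r : R) : tens a r = r *: tens1 a.
Proof. by rewrite tensR_scale_tens mulr1. Qed.

Lemma linear_tens_ext (V : lmodType R) (f g : tensR R A -> V) :
  linear f -> linear g -> (forall a, f (tens1 a) = g (tens1 a)) -> f =1 g.
Proof.
move=> fL gL fg.
pose f' : {linear tensR R A -> V} :=
  HB.pack f (GRing.isLinear.Build _ _ _ _ f fL).
pose g' : {linear tensR R A -> V} :=
  HB.pack g (GRing.isLinear.Build _ _ _ _ g gL).
elim/tensor_ind => [|s t IHs IHt|a r].
- exact: etrans (raddf0 f') (esym (raddf0 g')).
- by rewrite -[LHS]/(f' _) -[RHS]/(g' _) !linearB /= IHs IHt.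
- by rewrite tensE -[LHS]/(f' _) -[RHS]/(g' _) !linearZ /= fg.
Qed.

Variable chi : {additive A -> R}.

Definition scalar_ext : tensR R A -> R^o := tensor_lift (fun a r => chi a * r).

Let chiDl a a' r : chi (a + a') * r = chi a * r + chi a' * r.
Proof. by rewrite raddfD mulrDl. Qed.

Let chiDr a r r' : chi a * (r + r') = chi a * r + chi a * r'.
Proof. exact: mulrDr. Qed.

Lemma scalar_ext_is_linear : linear scalar_ext.
Proof.
pose ext : {additive tensR R A -> R} := HB.pack scalar_ext
  (GRing.isZmodMorphism.Build _ _ scalar_ext
     (tensor_lift_is_zmod_morphism chiDl chiDr)).
have extB : {morph scalar_ext : s t / s - t} by exact: (raddfB ext).
have extD : {morph scalar_ext : s t / s + t} by exact: (raddfD ext).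
have ext0 : scalar_ext 0 = 0 by exact: (raddf0 ext).
move=> r s t; rewrite extD; congr (_ + _).
elim/tensor_ind: s => [|s s' IHs IHs'|a x].
- by rewrite scaler0 ext0 scaler0.
- by rewrite scalerBr !extB IHs IHs' scalerBr.
- rewrite tensR_scale_tens /scalar_ext !(tensor_lift_tens chiDl chiDr).
  exact: mulrCA.
Qed.

HB.instance Definition _ := GRing.isLinear.Build R (tensR R A) R^o
  *:%R scalar_ext scalar_ext_is_linear.

Lemma scalar_ext_tens1 a : scalar_ext (tens1 a) = chi a.
Proof. by rewrite /scalar_ext (tensor_lift_tens chiDl chiDr) mulr1. Qed.

End ScalarExtensionOfFunctions.

Lemma finite_range_additive_torsion (A H : zmodType) (p : {additive A -> H}) x :
  finite_range p -> exists2 n, (0 < n)%N & p x *+ n = 0.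
Proof.
move=> fp.
have [i [j [ij pij]]] :
    exists i j : nat, (i < j)%N /\ p (x *+ i) = p (x *+ j).
  apply: contrapT => noneq; have := infinite_nat; apply.
  pose f k := p (x *+ k); rewrite -(preimage_range f).
  apply: (@finite_preimage _ _ (range f) f).
    move=> i j _ _ pij; case: (ltngtP i j) => // lt.
      by case: noneq; exists i, j.
    by case: noneq; exists j, i.
  by apply: sub_finite_set fp => _ [k _ <-]; exists (x *+ k).
exists (j - i)%N; first by rewrite subn_gt0.
by rewrite mulrnBr ?(ltnW ij) // -!raddfMn pij subrr.
Qed.

Section Coordinates.
Variables (R : realType) (H : zmodType) (m : nat) (h : 'I_m -> H).
Variable chi : 'I_m -> {additive H -> int}.
Hypothesis split : finite_range (fun x => x - \sum_j h j *~ chi j x).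

Definition coordR j : {linear tensR R H -> R^o} :=
  scalar_ext (intr \o chi j : {additive H -> R}).

Lemma coordR_tens1 j x : coordR j (tens1 R x) = (chi j x)%:~R.
Proof. by rewrite /= scalar_ext_tens1. Qed.

Let residue x := x - \sum_j h j *~ chi j x.

Let residueB : zmod_morphism residue.
Proof.
move=> x y; rewrite /residue.
have -> : \sum_j h j *~ chi j (x - y) =
    \sum_j h j *~ chi j x - \sum_j h j *~ chi j y.
  by rewrite -sumrB; apply: eq_bigr => j _; rewrite raddfB mulrzBr.
by rewrite !opprD !opprK addrACA.
Qed.

(** The residue of x is additive in x with finite range, hence torsion, and a
    real vector space has no torsion. *)
Lemma tens1_split x :
  tens1 R x = \sum_j (chi j x)%:~R *: tens1 R (h j).
Proof.
pose p : {additive H -> H} :=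
  HB.pack residue (GRing.isZmodMorphism.Build _ _ residue residueB).
have [n n0 pn] := @finite_range_additive_torsion H H p x split.
have : tens1 R (p x) = 0.
  have /(congr1 (fun y => n%:R^-1 *: y)) : tens1 R (p x) *+ n = 0.
    by rewrite -raddfMn /= [p x *+ n]pn raddf0.
  by rewrite scaler0 -scaler_nat scalerA mulVf ?scale1r // pnatr_eq0 -lt0n.
rewrite /= /residue raddfB raddf_sum /= => /subr0_eq ->.
by apply: eq_bigr => j _; rewrite raddfMz scaler_int.
Qed.

Lemma tensR_split y : y = \sum_j coordR j y *: tens1 R (h j).
Proof.
apply: (@linear_tens_ext R H (tensR R H) id
  (fun y => \sum_j coordR j y *: tens1 R (h j))) => [//|r s t|x].
  rewrite scaler_sumr -big_split /=; apply: eq_bigr => j _.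
  by rewrite linearP scalerDl scalerA.
by rewrite [LHS]tens1_split; apply: eq_bigr => j _; rewrite coordR_tens1.
Qed.

Lemma tensR_separated (y : tensR R H) :
  (forall l : {linear tensR R H -> R^o}, l y = 0) -> y = 0.
Proof.
by move=> ly; rewrite (tensR_split y) big1 // => j _; rewrite ly scale0r.
Qed.

End Coordinates.

(** * Linear maps at bounded distance from a function *)

Section Approximation.
Variables (R : realType) (G H : zmodType).
Implicit Types (f : G -> H) (F : linear_hom (tensR R G) (tensR R H)).

(** Boundedness in H (x) R is tested on linear functionals, so that no norm has
    to be chosen and composition with linear maps is harmless. *)
Definition approximates f F := forall l : {linear tensR R H -> R^o},
  exists C, forall x, `|l (tens1 R (f x)) - l (F (tens1 R x))| <= C.

Lemma linear_hom_linear F : linear F.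
Proof. exact/asboolP/linear_hom_valP. Qed.

Lemma linear_hom_ext F F' :
  (forall x, F (tens1 R x) = F' (tens1 R x)) -> F = F'.
Proof.
move=> FF'; apply/val_inj/funext; apply: linear_tens_ext => //.
  exact: linear_hom_linear.
exact: linear_hom_linear.
Qed.

Definition linear_hom_tens1 F (x : G) : tensR R H := F (tens1 R x).

Lemma linear_hom_tens1B F : zmod_morphism (linear_hom_tens1 F).
Proof.
move=> x y; rewrite /linear_hom_tens1 raddfB.
by rewrite addrC -scaleN1r linear_hom_linear scaleN1r addrC.
Qed.

HB.instance Definition _ F := GRing.isZmodMorphism.Build _ _
  (linear_hom_tens1 F) (linear_hom_tens1B F).

Lemma approximatesB f g F K : approximates f F -> approximates g K ->
  approximates (f - g) (F - K).
Proof.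
move=> fF gK l; have [C fC] := fF l; have [D gD] := gK l.
exists (C + D) => x; apply: le_trans (lerD (fC x) (gD x)).
apply: le_trans (ler_normB _ _).
by rewrite -[(f - g) x]/(f x - g x) -[(F - K) _]/(F _ - K _) !raddfB /= addrACA.
Qed.

Lemma bounded_approximates f : f \in @bounded G H -> approximates f 0.
Proof.
move=> /asboolP ff l; have [C fC] :=
  finite_range_bounded (fun y => l (tens1 R y) : R) ff.
exists C => x; rewrite -[(0 : linear_hom _ _) _]/(0 : tensR R H).
by rewrite raddf0 subr0; exact: fC.
Qed.

Section Target.
Variables (m : nat) (h : 'I_m -> H) (chi : 'I_m -> {additive H -> int}).
Hypothesis split : finite_range (fun x => x - \sum_j h j *~ chi j x).

(** On the multiples of x (x) 1, a functional composed with F is n |-> n t,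
    which is bounded only for t = 0. *)
Lemma approximates0_eq0 F : approximates 0 F -> F = 0.
Proof.
move=> F0; apply: linear_hom_ext => x; apply: (tensR_separated split) => l.
have [C FC] := F0 l; apply: (@mulrn_bounded_eq0 _ _ C) => n.
have := FC (x *+ n); rewrite -[(0 : G -> H) _]/(0 : H) !raddf0 sub0r normrN.
rewrite -[F (tens1 R (x *+ n))]/(linear_hom_tens1 F (x *+ n)).
by rewrite raddfMn /= raddfMn.
Qed.

Lemma approximates_unique f F F' :
  approximates f F -> approximates f F' -> F = F'.
Proof.
move=> fF fF'; apply/subr0_eq/approximates0_eq0.
by have := approximatesB fF fF'; rewrite subrr.
Qed.

Lemma bounded_combinations (T : Type) (a b : 'I_m -> T -> R)
    (l : {linear tensR R H -> R^o}) :
  (forall j, exists C, forall x, `|a j x - b j x| <= C) ->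
  exists C, forall x, `|l (\sum_j a j x *: tens1 R (h j)) -
                       l (\sum_j b j x *: tens1 R (h j))| <= C.
Proof.
move=> /choice[C abC]; exists (\sum_j C j * `|l (tens1 R (h j)) : R|) => x.
rewrite -raddfB -sumrB raddf_sum; apply: le_trans (ler_norm_sum _ _ _) _.
apply: ler_sum => j _; rewrite -scalerBl /= linearZ /= normrM.
by apply: ler_wpM2r; [exact: normr_ge0 | exact: abC].
Qed.

Lemma approximates0_bounded f : approximates f 0 -> f \in @bounded G H.
Proof.
move=> fF; apply/asboolP.
have -> : f = (fun x => (f x - \sum_j h j *~ chi j (f x)) +
                        \sum_j h j *~ chi j (f x)).
  by apply/funext => x; rewrite subrK.
apply: finite_rangeD.
  by apply: sub_finite_set split => _ [x _ <-]; exists (f x).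
apply: finite_range_sum => j _.
apply: (@finite_range_comp _ _ _ (fun k : int => h j *~ k) (chi j \o f)).
have [C fC] := fF (coordR R chi j).
apply: (@bounded_int_finite_range R _ _ C) => x; have := fC x.
by rewrite coordR_tens1 -[(0 : linear_hom _ _) _]/(0 : tensR R H) raddf0 subr0.
Qed.

Lemma approximation_exists (f : almost_hom G H) : exists F, approximates f F.
Proof.
have /asboolP ff := almost_hom_valP f.
have /choice[phi phiP] : forall j, exists phi : {additive G -> R},
    exists C, forall x, `|(chi j (f x))%:~R - phi x| <= C.
  move=> j; have [C fC] := finite_range_bounded
    (fun y => (chi j y)%:~R : R) ff.
  have [x y|phi phiC] :=
    @quasi_additive_limit R G (fun x => (chi j (f x))%:~R) C.
    by have := fC (x, y); rewrite /defect /= !raddfB.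
  by exists phi, C.
pose F y : tensR R H := \sum_j scalar_ext (phi j) y *: tens1 R (h j).
have FL : F \in @is_linear R (tensR R G) (tensR R H).
  apply/asboolP => r s t; rewrite /F scaler_sumr -big_split.
  by apply: eq_bigr => j _; rewrite linearP scalerDl scalerA.
exists (LinearHom FL) => l; have [C FC] := bounded_combinations l phiP.
exists C => x; rewrite (tens1_split R split) /=.
have -> : F (tens1 R x) = \sum_j phi j x *: tens1 R (h j).
  by apply: eq_bigr => j _; rewrite scalar_ext_tens1.
exact: FC.
Qed.

(** The function f rounds down the coordinates of F (x (x) 1).  Its defect is a
    combination of the h_j with coefficients in {0, 1}. *)
Lemma approximated_exists F : exists f : almost_hom G H, approximates f F.
Proof.
pose a j x : R := coordR R chi j (F (tens1 R x)).
pose f x := \sum_j h j *~ Num.floor (a j x).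
have fA : f \in @almost_additive G H.
  apply/asboolP.
  have -> : defect f = fun xy => \sum_j h j *~
      (Num.floor (a j (xy.1 + xy.2)) -
       Num.floor (a j xy.1) - Num.floor (a j xy.2)).
    apply/funext => xy; rewrite /defect /f -!sumrB; apply: eq_bigr => j _.
    by rewrite !mulrzBr.
  apply: finite_range_sum => j _.
  apply: (@finite_range_comp _ _ _ (fun k : int => h j *~ k)).
  apply: (@bounded_int_finite_range R _ _ 2) => -[x y] /=; rewrite !raddfB /=.
  have aD : a j (x + y) = a j x + a j y.
    rewrite /a -[F (tens1 R (x + y))]/(linear_hom_tens1 F (x + y)).
    by rewrite raddfD /= raddfD.
  have := floor_itv (a j (x + y)).
  have := floor_itv (a j x); have := floor_itv (a j y).
  rewrite !raddfD /= aD ler_norml => /andP[? ?] /andP[? ?] /andP[? ?].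
  by apply/andP; split; lra.
exists (AlmostHom fA) => l.
have floorP j : exists C, forall x, `|(Num.floor (a j x))%:~R - a j x| <= C.
  exists 1 => x; have := floor_itv (a j x).
  rewrite raddfD /= ler_norml => /andP[? ?].
  by apply/andP; split; lra.
have [C FC] := bounded_combinations l floorP.
exists C => x; rewrite (tensR_split split (F (tens1 R x))) /=.
have -> : tens1 R (f x) = \sum_j (Num.floor (a j x))%:~R *: tens1 R (h j).
  by rewrite raddf_sum; apply: eq_bigr => j _; rewrite raddfMz scaler_int.
exact: FC.
Qed.

End Target.
End Approximation.

(** * The natural isomorphism *)

Lemma inj_surj_bijective (A B : Type) (f : A -> B) :
  injective f -> (forall b, exists a, f a = b) -> bijective f.
Proof.
move=> f_inj /choice[g fg]; exists g; last exact: fg.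
by move=> x; apply: f_inj; rewrite fg.
Qed.

Section Linearization.
Variables (R : realType) (G H : zmodType).
Hypothesis fgH : finitely_generated H.

Lemma approximation_of_class (x : E G H) :
  exists F : linear_hom (tensR R G) (tensR R H), approximates (repr x) F.
Proof.
have [m [h [chi split]]] := finitely_generated_split fgH.
exact: approximation_exists split _.
Qed.

Definition linearization (x : E G H) : linear_hom (tensR R G) (tensR R H) :=
  sval (cid (approximation_of_class x)).

Lemma linearization_approximates (f : almost_hom G H) :
  approximates f (linearization (E_class f)).
Proof.
have := svalP (cid (approximation_of_class (E_class f))).
rewrite -/(linearization _) => reprF.
have Bf : repr (E_class f) - f \in @bounded_almost_hom G H.
  by apply/E_class_eq; rewrite /E_class reprK.
have := approximatesB reprF (@bounded_approximates R _ _ _ Bf).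
rewrite subr0; congr approximates; apply/funext => x.
exact: subKr.
Qed.

Lemma linearization_unique (f : almost_hom G H) F :
  approximates f F -> linearization (E_class f) = F.
Proof.
have [m [h [chi split]]] := finitely_generated_split fgH.
exact: approximates_unique split _ _ _ (linearization_approximates f).
Qed.

Lemma linearizationB : zmod_morphism linearization.
Proof.
move=> x y; rewrite -[x]reprK -[y]reprK -!/(E_class _) -E_classB.
by apply/linearization_unique/approximatesB; exact: linearization_approximates.
Qed.

HB.instance Definition _ :=
  GRing.isZmodMorphism.Build _ _ linearization linearizationB.

Lemma linearization_bijective : bijective linearization.
Proof.
have [m [h [chi split]]] := finitely_generated_split fgH.
apply: inj_surj_bijective => [|F].
  apply: raddf_inj => x; rewrite -[x]reprK -/(E_class _) => F0.
  have := linearization_approximates (repr x); rewrite F0.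
  move=> /(approximates0_bounded split) Bx.
  by rewrite -(subrr (E_class 0)) -E_classB; apply/E_class_eq; rewrite !subr0.
have [f fF] := approximated_exists split F.
by exists (E_class f); exact: linearization_unique.
Qed.

End Linearization.

Lemma approximates_comp (R : realType) (G G' H H' : zmodType)
    (u : {additive G' -> G}) (v : {additive H -> H'}) (f : G -> H)
    (F : linear_hom (tensR R G) (tensR R H)) :
  approximates f F ->
  approximates (v \o f \o u) (linear_hom_map (tensR_map R u) (tensR_map R v) F).
Proof.
move=> fF l.
have [C FC] := fF (l \o tensR_map R v : {linear tensR R H -> R^o}).
by exists C => x; have := FC (u x); rewrite /= /tens1 !tensR_map_tens.
Qed.

Lemma linearization_natural (R : realType) (G G' H H' : zmodType)
    (fgH : finitely_generated H) (fgH' : finitely_generated H')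
    (u : {additive G' -> G}) (v : {additive H -> H'}) (x : E G H) :
  linearization R fgH' (E_map u v x) =
  linear_hom_map (tensR_map R u) (tensR_map R v) (linearization R fgH x).
Proof.
rewrite -[x]reprK -/(E_class _) E_map_class.
exact/linearization_unique/approximates_comp/linearization_approximates.
Qed.

(** * Matrices of endomorphisms of Z^n (x) R *)

Section Matrices.
Variables (R : realType) (n : nat).
Local Notation Zn := 'rV[int]_n.

Definition entry (j : 'I_n) (c : Zn) : int := c 0 j.

Lemma entryB j : zmod_morphism (entry j).
Proof. by move=> c d; rewrite /entry !mxE. Qed.

HB.instance Definition _ j :=
  GRing.isZmodMorphism.Build _ _ (entry j) (entryB j).

Definition unit_row (j : 'I_n) : Zn := delta_mx 0 j.

Lemma row_entries (c : Zn) : c = \sum_j unit_row j *~ entry j c.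
Proof.
rewrite [LHS]row_sum_delta; apply: eq_bigr => j _.
by rewrite -scaler_int intz.
Qed.

Lemma finitely_generated_rV : finitely_generated Zn.
Proof. by exists n, unit_row => c; exists (entry^~ c); exact: row_entries. Qed.

Lemma row_split :
  finite_range (fun c : Zn => c - \sum_j unit_row j *~ entry j c).
Proof.
under eq_fun do rewrite -row_entries subrr.
exact: finite_range0.
Qed.

Let coord := @coordR R Zn n (fun j => entry j).

Lemma coord_unit_row i j : coord j (tens1 R (unit_row i)) = (i == j)%:R.
Proof. by rewrite coordR_tens1 /= /entry mxE eqxx eq_sym; case: eqP. Qed.

Lemma sum_kronecker_scale (V : lmodType R) (i : 'I_n) (v : 'I_n -> V) :
  \sum_k (i == k)%:R *: v k = v i.
Proof.
rewrite (bigD1 i) //= eqxx scale1r big1 ?addr0 // => k.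
by rewrite eq_sym => /negbTE->; rewrite scale0r.
Qed.

Definition matrix_of_hom (F : linear_hom (tensR R Zn) (tensR R Zn)) : 'M[R]_n :=
  \matrix_(i, j) coord j (F (tens1 R (unit_row i))).

Lemma matrix_of_homB : zmod_morphism matrix_of_hom.
Proof. by move=> F K; apply/matrixP => i j; rewrite !mxE -raddfB. Qed.

HB.instance Definition _ :=
  GRing.isZmodMorphism.Build _ _ matrix_of_hom matrix_of_homB.

Lemma matrix_of_hom_bijective : bijective matrix_of_hom.
Proof.
apply: inj_surj_bijective => [F K /matrixP FK|M].
  apply: linear_hom_ext => c; rewrite (tens1_split R row_split).
  have linE (L : linear_hom (tensR R Zn) (tensR R Zn)) :
      L (\sum_j (entry j c)%:~R *: tens1 R (unit_row j)) =
      \sum_j (entry j c)%:~R *: L (tens1 R (unit_row j)).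
    pose L' : {linear tensR R Zn -> tensR R Zn} :=
      HB.pack (linear_hom_val L)
        (GRing.isLinear.Build _ _ _ _ (linear_hom_val L) (linear_hom_linear L)).
    rewrite -[LHS]/(L' _) linear_sum; apply: eq_bigr => j _.
    by rewrite linearZ.
  rewrite !linE; apply: eq_bigr => i _; congr (_ *: _).
  rewrite [LHS](tensR_split row_split) [RHS](tensR_split row_split).
  by apply: eq_bigr => j _; have := FK i j; rewrite !mxE => ->.
pose F y : tensR R Zn :=
  \sum_i coord i y *: \sum_j M i j *: tens1 R (unit_row j).
have FL : F \in @is_linear R (tensR R Zn) (tensR R Zn).
  apply/asboolP => r s t; rewrite /F scaler_sumr -big_split.
  by apply: eq_bigr => j _; rewrite linearP scalerDl scalerA.
exists (LinearHom FL); apply/matrixP => i j; rewrite mxE.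
have -> : LinearHom FL (tens1 R (unit_row i)) =
    \sum_j M i j *: tens1 R (unit_row j).
  rewrite -[RHS](sum_kronecker_scale i
    (fun k => \sum_j M k j *: tens1 R (unit_row j))).
  by apply: eq_bigr => k _; rewrite coord_unit_row.
rewrite raddf_sum -[RHS](sum_kronecker_scale j (M i : 'I_n -> R^o)).
apply: eq_bigr => k _; rewrite eq_sym -coord_unit_row.
by rewrite [LHS]linearZ; exact: mulrC.
Qed.

End Matrices.

Theorem mainTheorem7 (R : realType) :
  (exists Phi : forall G H : fgAb,
       {additive E G H -> linear_hom (tensR R G) (tensR R H)},
     (forall G H : fgAb, bijective (Phi G H)) /\
     (forall (G G' H H' : fgAb)
             (u : {additive G' -> G}) (v : {additive H -> H'}) (x : E G H),
        Phi G' H' (E_map u v x) =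
        linear_hom_map (tensR_map R u) (tensR_map R v) (Phi G H x)))
  /\
  (forall n : nat,
     exists phi : {additive E 'rV[int]_n 'rV[int]_n -> 'M[R]_n}, bijective phi).
Proof.
split.
  exists (fun G H => linearization R (fgAb_axiom H)).
  by split=> *; [exact: linearization_bijective | exact: linearization_natural].
move=> n.
exists (@matrix_of_hom R n \o linearization R (finitely_generated_rV n)).
apply: bij_comp; first exact: matrix_of_hom_bijective.
exact: linearization_bijective.
Qed.
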